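(* Let $\Lambda$ be a finite dimensional algebra over a field and $k\ge1$ an integer. Then $$k\text{-}\operatorname{edell}\Lambda\le k\text{-}\operatorname{ddell}\Lambda\le k\text{-}\operatorname{dell}\Lambda .$$
   Context: Modules are right $\Lambda$-modules; $\mathrm{mod}\,\Lambda$ denotes the category of finitely generated ones. $\mathbb N$ is the set of nonnegative integers; the infimum of the empty set is $+\infty$. $\Omega M$ is the kernel of a projective cover of $M$, $\Omega^0M=M$, $\Omega^{n+1}M=\Omega(\Omega^nM)$. ''$A$ is a direct summand of $B$ up to projective summands'' means that $A$ is isomorphic to a direct summand of $B\oplus P$ for some projective $P$. For an integer $j\ge1$, $j\text{-}\operatorname{dell}M$ is the infimum of all $n\in\mathbb N$ such that $\Omega^nM$ is a direct summand of $\Omega^{n+j}N$ up to projective summands for some $N\in\mathrm{mod}\,\Lambda$. $k\text{-}\operatorname{edell}M$ is the infimum of all $n\in\mathbb N$ such that for every integer $k'\ge1$ and every right $\Lambda$-module $X$ of injective dimension $\mathrm{id}\,X=n+k-1+k'$ one has $\mathrm{Ext}_\Lambda^{n+k'}(M,X)=0$. $k\text{-}\operatorname{ddell}M$ is the infimum of all $m\in\mathbb N$ for which there exist an integer $0\le n\le m$ and an exact sequence $0\to C_n\to C_{n-1}\to\cdots\to C_1\to C_0\to M\to0$ in $\mathrm{mod}\,\Lambda$ with $(i+k)\text{-}\operatorname{dell}C_i\le m-i$ for $i=0,1,\dots,n$. For each of these three invariants, the value on $\Lambda$ is the supremum of the values on the simple right $\Lambda$-modules. *)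

(* Defs.v *)
From HB Require Import structures.
From mathcomp Require Import all_boot all_order all_algebra all_field.
From mathcomp Require Import boolp classical_sets.

Set Implicit Arguments.
Unset Strict Implicit.
Unset Printing Implicit Defensive.

Import GRing.Theory.

Inductive enat : Type := Fin of nat | Infty.

Definition leqe (a b : enat) : bool :=
  match a, b with
  | _, Infty => true
  | Infty, Fin _ => false
  | Fin m, Fin n => (m <= n)%N
  end.

Declare Scope enat_scope.
Delimit Scope enat_scope with EN.
Bind Scope enat_scope with enat.
Notation "a <= b" := (leqe a b) : enat_scope.
Notation "a <= b <= c" := (leqe a b && leqe b c) : enat_scope.

Definition einf (A : set nat) : enat :=
  if pselect (exists n, `[< A n >]) is left exA then Fin (ex_minn exA) else Infty.

(* The least upper bound: finite exactly when some natural number bounds A,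
   and 0 for the empty set. *)
Definition esup (A : set enat) : enat :=
  einf (fun n => forall a, A a -> (a <= Fin n)%EN).

Local Open Scope ring_scope.

(* Everything in this section is about left R-modules; right modules over an
   algebra L are obtained for R := L^c, the converse ring. *)
Section Modules.
Variable R : pzRingType.
Implicit Types (k n m j : nat) (A B C K L M N P S X : lmodType R).

Definition surjective M N (f : {linear M -> N}) : Prop :=
  forall y, exists x, f x = y.

Definition exact L M N (f : {linear L -> M}) (g : {linear M -> N}) : Prop :=
  forall y, g y = 0 <-> exists x, f x = y.

Definition zero_module M : Prop := forall x : M, x = 0.

Definition isomorphic M N : Prop := exists f : {linear M -> N}, bijective f.

Definition finitely_generated M : Prop :=
  exists n (e : 'I_n -> M), forall x, exists c : 'I_n -> R,
    x = \sum_(i < n) c i *: e i.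

Definition simple_module S : Prop :=
  (exists x : S, x != 0) /\
  forall U : {pred S}, submod_closed U ->
    (forall x, x \in U -> x = 0) \/ (forall x, x \in U).

Definition projective_module P : Prop :=
  forall M N (g : {linear M -> N}) (f : {linear P -> N}), surjective g ->
    exists h : {linear P -> M}, forall x, g (h x) = f x.

Definition injective_module X : Prop :=
  forall M N (i : {linear M -> N}) (f : {linear M -> X}), injective i ->
    exists h : {linear N -> X}, forall x, h (i x) = f x.

(* An essential epimorphism from a projective module. *)
Definition projective_cover P M (p : {linear P -> M}) : Prop :=
  [/\ projective_module P, surjective p
    & forall L (g : {linear L -> P}),
        (forall y, exists x, p (g x) = y) -> surjective g].

(* K is (a model of) Omega M, which is defined up to isomorphism only. *)
Definition syzygy M K : Prop :=
  exists P (p : {linear P -> M}) (i : {linear K -> P}),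
    [/\ projective_cover p, injective i & exact i p].

(* nsyzygy n M K : K is (a model of) Omega^n M. *)
Inductive nsyzygy M : nat -> lmodType R -> Prop :=
| nsyzygy0 : nsyzygy M 0 M
| nsyzygyS n L K : nsyzygy M n L -> syzygy L K -> nsyzygy M n.+1 K.

Definition direct_summand A B : Prop :=
  exists C, isomorphic (A * C)%type B.

Definition stable_summand A B : Prop :=
  exists2 P, projective_module P & direct_summand A (B * P)%type.

(* Exact sequences ... -> C_1 -> C_0 -> M -> 0. *)
Record resolution M := Resolution {
  res_obj :> nat -> lmodType R;
  res_d : forall i, {linear res_obj i.+1 -> res_obj i};
  res_aug : {linear res_obj 0%N -> M};
  res_aug_surj : surjective res_aug;
  res_exact0 : exact (res_d 0%N) res_aug;
  res_exact : forall i, exact (res_d i.+1) (res_d i)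
}.

(* Exact sequences 0 -> X -> I^0 -> I^1 -> ... *)
Record coresolution X := Coresolution {
  cores_obj :> nat -> lmodType R;
  cores_d : forall i, {linear cores_obj i -> cores_obj i.+1};
  cores_aug : {linear X -> cores_obj 0%N};
  cores_aug_inj : injective cores_aug;
  cores_exact0 : exact cores_aug (cores_d 0%N);
  cores_exact : forall i, exact (cores_d i) (cores_d i.+1)
}.

(* Infimum of the lengths of the injective resolutions of X. *)
Definition inj_dim X : enat :=
  einf (fun n => exists I : coresolution X,
    (forall i, injective_module (I i)) /\
    (forall i, (n < i)%N -> zero_module (I i))).

Definition cocycle M X (P : resolution M) n (f : {linear P n -> X}) : Prop :=
  forall x, f (res_d P n x) = 0.

Definition coboundary M X (P : resolution M) n : {linear P n -> X} -> Prop :=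
  match n with
  | 0%N => fun f => forall x, f x = 0
  | n'.+1 => fun f => exists g : {linear P n' -> X}, forall x, f x = g (res_d P n' x)
  end.

(* Ext^n(M, X) = 0, where Ext^n(M, X) is the n-th cohomology group of Hom(P, X)
   for a projective resolution P of M; it does not depend on P. *)
Definition Ext_vanishes n M X : Prop :=
  forall P : resolution M, (forall i, projective_module (P i)) ->
    forall f : {linear P n -> X}, cocycle f -> coboundary f.

Definition dell j M : enat :=
  einf (fun n => exists N, finitely_generated N /\
    exists K L, [/\ nsyzygy M n K, nsyzygy N (n + j) L & stable_summand K L]).

Definition edell k M : enat :=
  einf (fun n => forall k', (1 <= k')%N ->
    forall X, inj_dim X = Fin (n + k - 1 + k') -> Ext_vanishes (n + k') M X).

(* The exact sequence 0 -> C_n -> ... -> C_0 -> M -> 0 is encoded as an infinite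
   one with C_i = 0 for i > n. *)
Definition ddell k M : enat :=
  einf (fun m => exists n, (n <= m)%N /\ exists C : resolution M,
    [/\ forall i, finitely_generated (C i),
        forall i, (n < i)%N -> zero_module (C i)
      & forall i, (i <= n)%N -> (dell (i + k) (C i) <= Fin (m - i))%EN]).

Definition sup_simples (d : lmodType R -> enat) : enat :=
  esup (fun a => exists2 S, simple_module S & a = d S).

End Modules.

Section Algebra.
Variables (F : fieldType) (Lambda : falgType F).

Definition dell_alg (k : nat) : enat := sup_simples (@dell Lambda^c k).
Definition edell_alg (k : nat) : enat := sup_simples (@edell Lambda^c k).
Definition ddell_alg (k : nat) : enat := sup_simples (@ddell Lambda^c k).

End Algebra.

(* Main.v *)
From HB Require Import structures.
Require Import Defs.
From mathcomp Require Import all_boot all_order all_algebra all_field.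
From mathcomp Require Import boolp.

(** Fix [X] of injective dimension [m + k - 1 + k'] and compute Ext^t(-, X) from
    an injective resolution [I] of [X], so that every module in sight only enters
    through [Hom(-, I)].  If Omega^n C is a stable summand of Omega^(n+j) N, then
    shifting dimension up from C and down to N embeds Ext^t(C, X) into
    Ext^(t+j)(N, X), which is 0 when [t + j] exceeds the injective dimension.
    For an exact sequence 0 -> C_n -> ... -> C_0 -> M -> 0 with
    [(i+k)-dell C_i <= m - i] this kills all Ext^(m+k'-i)(C_i, X), hence
    Ext^(m+k')(M, X).  The second inequality uses the sequence
    0 -> M -> M -> 0. *)

Set Implicit Arguments.
Unset Strict Implicit.
Unset Printing Implicit Defensive.

Import GRing.Theory.
Local Open Scope ring_scope.

Lemma einf_le_mem (A : nat -> Prop) n : A n -> (einf A <= Fin n)%EN.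
Proof.
rewrite /einf => An; case: pselect => [exA|[]]; last by exists n; apply/asboolP.
by case: ex_minnP => m _ min_m; apply: min_m; apply/asboolP.
Qed.

Lemma einf_eqP (A : nat -> Prop) n : einf A = Fin n -> A n.
Proof.
by rewrite /einf; case: pselect => // exA [<-]; case: ex_minnP => m /asboolP.
Qed.

Lemma einf_leP (A : nat -> Prop) n :
  (einf A <= Fin n)%EN -> exists2 m, (m <= n)%N & A m.
Proof.
by case defA: (einf A) => [m|] //= le_mn; exists m => //; apply: einf_eqP.
Qed.

Lemma le_einf (A : nat -> Prop) a :
  (forall n, A n -> (a <= Fin n)%EN) -> (a <= einf A)%EN.
Proof.
move=> leA; case defA: (einf A) => [n|]; last by case: a leA.
by apply: leA; apply: einf_eqP.
Qed.

Lemma leqe_trans a b c : (a <= b)%EN -> (b <= c)%EN -> (a <= c)%EN.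
Proof. by case: a b c => [a|] [b|] [c|] //=; apply: leq_trans. Qed.

Section Modules.
Variable R : pzRingType.
Implicit Types (k n m j s t : nat) (A B C K L M N P S X : lmodType R).

Lemma le_sup_simples (d e : lmodType R -> enat) :
  (forall S, simple_module S -> (d S <= e S)%EN) ->
  (sup_simples d <= sup_simples e)%EN.
Proof.
move=> le_de; apply: le_einf => n ub_n; apply: einf_le_mem => _ [S simS ->].
by apply: leqe_trans (le_de S simS) (ub_n _ _); exists S.
Qed.

Lemma linear_of M N (f : M -> N) :
  linear f -> exists g : {linear M -> N}, g =1 f.
Proof.
move=> f_lin; pose fL := GRing.isLinear.Build R M N *:%R f f_lin.
pose g : {linear M -> N} := HB.pack f fL.
by exists g.
Qed.

Section Kernel.
Variables (M N : lmodType R) (g : {linear M -> N}).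

Definition ker_pred : {pred M} := [pred x | g x == 0].

Fact ker_pred_submod_closed : submod_closed ker_pred.
Proof.
split=> [|a x y]; rewrite !inE ?linear0 // => /eqP gx /eqP gy.
by rewrite linearP gx gy scaler0 addr0.
Qed.
HB.instance Definition _ :=
  GRing.isSubmodClosed.Build R M ker_pred ker_pred_submod_closed.

Record kernel := Kernel { kernel_val :> M; _ : kernel_val \in ker_pred }.
HB.instance Definition _ := [isSub for kernel_val].
HB.instance Definition _ := [Choice of kernel by <:].
HB.instance Definition _ := [SubChoice_isSubLmodule of kernel by <:].

End Kernel.

Lemma kernelP M N (g : {linear M -> N}) :
  exists K (i : {linear K -> M}), injective i /\ exact i g.
Proof.
exists (kernel g), (\val : {linear kernel g -> M}); split; first exact: val_inj.
move=> y; split=> [gy | [x <-]]; last exact/eqP/(valP x).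
have ker_y : y \in ker_pred g by rewrite inE gy.
by exists (Kernel ker_y).
Qed.

Lemma lift_inj A B C (i : {linear A -> B}) (f : {linear C -> B}) :
  injective i -> (forall x, exists y, i y = f x) ->
  exists h : {linear C -> A}, forall x, i (h x) = f x.
Proof.
move=> i_inj im_f; pose h x := sval (cid (im_f x)).
have hE x : i (h x) = f x by rewrite /h; case: cid.
have [a x y|g gE] := @linear_of _ _ h.
  by apply: i_inj; rewrite linearP !hE linearP.
by exists g => x; rewrite gE.
Qed.

Lemma factor_surj A B C (p : {linear A -> B}) (f : {linear A -> C}) :
  surjective p -> (forall x, p x = 0 -> f x = 0) ->
  exists h : {linear B -> C}, forall x, h (p x) = f x.
Proof.
move=> p_surj ker_f; pose s y := sval (cid (p_surj y)).
have sE y : p (s y) = y by rewrite /s; case: cid.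
have fE x y : p x = p y -> f x = f y.
  by move=> pxy; apply/eqP; rewrite -subr_eq0 -linearB ker_f // linearB pxy subrr.
have [a x y|g gE] := @linear_of _ _ (f \o s).
  by rewrite -linearP; apply: fE; rewrite linearP !sE.
by exists g => x; rewrite gE; apply: fE.
Qed.

Lemma projective_lift_exact P L M N (f : {linear L -> M}) (g : {linear M -> N})
    (h : {linear P -> M}) :
  projective_module P -> exact f g -> (forall x, g (h x) = 0) ->
  exists h' : {linear P -> L}, forall x, f (h' x) = h x.
Proof.
move=> projP exfg gh0; have [K [i [i_inj exK]]] := kernelP g.
have [y|f' f'E] := lift_inj (f := f) i_inj; first by apply/exK/exfg; exists y.
have [x|h1 h1E] := lift_inj (f := h) i_inj; first exact/exK/gh0.
have f'_surj : surjective f'.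
  move=> y; have [|x fx] := (exfg (i y)).1; first by apply/exK; exists y.
  by exists x; apply: i_inj; rewrite f'E.
have [h' h'E] := projP _ _ f' h1 f'_surj.
by exists h' => x; rewrite -f'E h'E h1E.
Qed.

Definition shift_resolution M (C : resolution M) K (e : {linear C 1%N -> K})
    (e_surj : surjective e) (e_exact : exact (res_d C 1) e) : resolution K :=
  @Resolution R K (fun n => C n.+1) (fun n => res_d C n.+1) e e_surj e_exact
    (fun n => @res_exact _ _ C n.+1).

Lemma shift_aug M (C : resolution M) K (i : {linear K -> C 0%N}) :
  injective i -> exact i (res_aug C) ->
  exists e : {linear C 1%N -> K},
    [/\ surjective e, exact (res_d C 1) e & forall x, i (e x) = res_d C 0 x].
Proof.
move=> i_inj ex_i; have [x|e eE] := lift_inj (f := res_d C 0) i_inj.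
  by apply/ex_i/res_exact0; exists x.
exists e; split=> // [y|y].
  have [|x dx] := (res_exact0 (r := C) (i y)).1; first by apply/ex_i; exists y.
  by exists x; apply: i_inj; rewrite eE.
have ->: (e y = 0) = (res_d C 0 y = 0); last exact: res_exact.
by rewrite -eE propeqE; split=> [->|]; rewrite ?linear0 // -(linear0 i) => /i_inj.
Qed.

Section ExtByCoresolution.
Variables (X : lmodType R) (I : coresolution X).
Hypothesis injI : forall i, injective_module (I i).

Definition coExt_coboundary M t : {linear M -> I t} -> Prop :=
  match t with
  | 0%N => fun f => forall x, f x = 0
  | t'.+1 => fun f =>
      exists g : {linear M -> I t'}, forall x, f x = cores_d I t' (g x)
  end.

Definition coExt_vanishes t M : Prop :=
  forall f : {linear M -> I t},
    (forall x, cores_d I t (f x) = 0) -> coExt_coboundary f.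

Lemma cores_dd t x : cores_d I t.+1 (cores_d I t x) = 0.
Proof. by apply/(@cores_exact _ _ I t); exists x. Qed.

Lemma cores_d_aug x : cores_d I 0 (cores_aug I x) = 0.
Proof. by apply/(@cores_exact0 _ _ I); exists x. Qed.

Lemma coExt_zero_module t M : zero_module M -> coExt_vanishes t M.
Proof.
move=> M0; case: t => [|t] f _ /=; first by move=> x; rewrite (M0 x) linear0.
by exists \0 => x; rewrite (M0 x) !linear0.
Qed.

Lemma coExt_zero_obj t M : zero_module (I t) -> coExt_vanishes t M.
Proof.
move=> It0; case: t It0 => [|t] It0 f _ /=; first by move=> x; apply: It0.
by exists \0 => x; rewrite linear0; apply: It0.
Qed.

Lemma coExt_projective t P : projective_module P -> coExt_vanishes t.+1 P.
Proof.
move=> projP f df0.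
have [g gE] := projective_lift_exact projP (@cores_exact _ _ I t) df0.
by exists g => x; rewrite gE.
Qed.

Lemma coExt_extension t K C M (i : {linear K -> C}) (p : {linear C -> M}) :
  injective i -> exact i p -> surjective p ->
  coExt_vanishes t K -> coExt_vanishes t.+1 C -> coExt_vanishes t.+1 M.
Proof.
move=> i_inj ex_ip p_surj K0 C0 f df0.
have pi0 x : p (i x) = 0 by apply/ex_ip; exists x.
have [x|g gE] := C0 (f \o p : {linear C -> I t.+1}); first exact: df0.
have [g' [g'i g'E]] : exists g' : {linear C -> I t},
    (forall x, g' (i x) = 0) /\ (forall x, cores_d I t (g' x) = f (p x)).
  have: coExt_coboundary (g \o i : {linear K -> I t}).
    by apply: K0 => x; rewrite -gE /= pi0 linear0.
  case: t {K0 C0} f df0 g gE => [|t] f df0 g gE /= => [gi0 | [h hE]].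
    by exists g; split=> // x; rewrite -gE.
  have [h' h'E] := injI h i_inj.
  exists (g \- (cores_d I t \o h') : {linear C -> I t.+1}); split=> x /=.
    by rewrite h'E hE subrr.
  by rewrite linearB cores_dd subr0 -gE.
have [x /ex_ip[y <-]|h hE] := factor_surj (f := g') p_surj; first exact: g'i.
by exists h => y; have [x <-] := p_surj y; rewrite hE g'E.
Qed.

Lemma coExt_kernel t K C M (i : {linear K -> C}) (p : {linear C -> M}) :
  injective i -> exact i p -> surjective p ->
  coExt_vanishes t.+1 C -> coExt_vanishes t.+2 M -> coExt_vanishes t.+1 K.
Proof.
move=> i_inj ex_ip p_surj C0 M0 f df0.
have pi0 x : p (i x) = 0 by apply/ex_ip; exists x.
have [f' f'E] := injI f i_inj.
have [x /ex_ip[y <-]|g gE] :=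
    factor_surj (f := cores_d I t.+1 \o f' : {linear C -> I t.+2}) p_surj.
  by rewrite /= f'E df0.
have [y|h hE] := M0 g; first by have [x <-] := p_surj y; rewrite gE /= cores_dd.
have [x|u uE] := C0 (f' \- (h \o p) : {linear C -> I t.+1}).
  by rewrite /= linearB -hE gE /= subrr.
exists (u \o i : {linear K -> I t}) => x.
by rewrite /= -uE /= f'E pi0 linear0 subr0.
Qed.

Lemma coExt_syzygyS s L K :
  syzygy L K -> coExt_vanishes s K -> coExt_vanishes s.+1 L.
Proof.
move=> [P [p [i [[projP p_surj _] i_inj ex_ip]]]] K0.
exact: (coExt_extension i_inj ex_ip p_surj K0 (coExt_projective projP)).
Qed.

Lemma coExt_syzygy s L K :
  syzygy L K -> coExt_vanishes s.+2 L -> coExt_vanishes s.+1 K.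
Proof.
move=> [P [p [i [[projP p_surj _] i_inj ex_ip]]]] L0.
exact: (coExt_kernel i_inj ex_ip p_surj (coExt_projective projP) L0).
Qed.

Lemma coExt_nsyzygyS s n M K :
  nsyzygy M n K -> coExt_vanishes s K -> coExt_vanishes (s + n) M.
Proof.
move=> syzK; elim: syzK s => [|{}n L {}K _ IH LK] s; first by rewrite addn0.
by move=> K0; rewrite addnS -addSn; apply/IH/(coExt_syzygyS LK).
Qed.

Lemma coExt_nsyzygy s n M K :
  nsyzygy M n K -> coExt_vanishes (s.+1 + n) M -> coExt_vanishes s.+1 K.
Proof.
move=> syzK; elim: syzK s => [|{}n L {}K _ IH LK] s; first by rewrite addn0.
by rewrite addnS -addSn => M0; apply/(coExt_syzygy LK)/IH.
Qed.

Lemma coExt_stable_summand s A B :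
  stable_summand A B -> coExt_vanishes s.+1 B -> coExt_vanishes s.+1 A.
Proof.
move=> [P projP [C [u [v uK vK]]]] B0 f df0; have P0 := @coExt_projective s P projP.
have [a x y|v' v'E] := @linear_of _ _ v.
  by apply: (can_inj uK); rewrite linearP !vK.
have [a x y|iB iBE] := @linear_of B (B * P)%type (fun b => (b, 0)).
  by apply/pair_equal_spec; rewrite /= scaler0 addr0.
have [a x y|iP iPE] := @linear_of P (B * P)%type (fun x => (0, x)).
  by apply/pair_equal_spec; rewrite /= scaler0 addr0.
have [a x y|iA iAE] := @linear_of A (A * C)%type (fun x => (x, 0)).
  by apply/pair_equal_spec; rewrite /= scaler0 addr0.
pose f' : {linear (B * P)%type -> I s.+1} := f \o (fst \o v').
have [x|gB gBE] := B0 (f' \o iB : {linear B -> I s.+1}); first exact: df0.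
have [x|gP gPE] := P0 (f' \o iP : {linear P -> I s.+1}); first exact: df0.
exists ((gB \o (fst \o (u \o iA))) \+ (gP \o (snd \o (u \o iA)))
  : {linear A -> I s}) => x.
have -> : f x = (f' \o iB) (u (iA x)).1 + (f' \o iP) (u (iA x)).2.
  rewrite /comp -linearD iBE iPE.
  have -> : ((u (iA x)).1, 0) + (0, (u (iA x)).2) = u (iA x).
    rewrite [RHS]surjective_pairing; apply/pair_equal_spec.
    by rewrite /= addr0 add0r.
  by rewrite /= v'E uK iAE.
by rewrite gBE gPE; apply/esym/linearD.
Qed.

Lemma coExt_dell j p s M :
  (dell j M <= Fin p)%EN ->
  (forall N t, (p + s.+1 + j <= t)%N -> coExt_vanishes t N) ->
  coExt_vanishes (p + s.+1) M.
Proof.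
move=> /einf_leP[n le_np [N [_ [K [L [syzK syzL sumK]]]]]] N0.
have -> : (p + s.+1 = (p - n + s).+1 + n)%N by rewrite addnS addSn addnAC subnK.
apply: (coExt_nsyzygyS syzK); apply: coExt_stable_summand sumK _.
apply: (coExt_nsyzygy syzL); apply: N0.
by rewrite addSn addnA (addnAC (p - n)%N) subnK // addnS addSn.
Qed.

Lemma coExt_resolution t M (C : resolution M) :
  zero_module (C t) ->
  (forall i, (i < t)%N -> coExt_vanishes (t - i) (C i)) -> coExt_vanishes t M.
Proof.
elim: t M C => [|t IH] M C Ct0 C0.
  apply: coExt_zero_module => y.
  by have [x <-] := res_aug_surj C y; rewrite (Ct0 x) linear0.
have [K [i [i_inj ex_i]]] := kernelP (res_aug C).
have [e [e_surj ex_e _]] := shift_aug i_inj ex_i.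
apply: (coExt_extension i_inj ex_i (res_aug_surj C)); last exact: (C0 0%N).
by apply: (IH K (shift_resolution e_surj ex_e)) => // n lt_nt; apply: (C0 n.+1).
Qed.

(* Balancing of Ext: it suffices to treat degree 1, by dimension shifting. *)
Lemma Ext_vanishes_coExt t M : coExt_vanishes t.+1 M -> Ext_vanishes t.+1 M X.
Proof.
move=> M0 P projP; elim: t M M0 P projP => [|t IH] M M0 P projP f cf.
  have [K [i [i_inj ex_i]]] := kernelP (res_aug P).
  have [e [e_surj ex_e eE]] := shift_aug i_inj ex_i.
  have [x /ex_e[y <-]|h hE] := factor_surj (f := f) e_surj; first exact: cf.
  have [g gE] := injI (cores_aug I \o h : {linear K -> I 0%N}) i_inj.
  have [x /ex_i[y <-]|u uE] := factor_surj
      (f := cores_d I 0 \o g : {linear P 0%N -> I 1%N}) (res_aug_surj P).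
    by rewrite /= gE /= cores_d_aug.
  have [y|v vE] := M0 u.
    by have [x <-] := res_aug_surj P y; rewrite uE /= cores_dd.
  pose w : {linear P 0%N -> I 0%N} := g \- (v \o res_aug P).
  have [x|w' w'E] := lift_inj (f := w) (@cores_aug_inj _ _ I).
    by apply/(@cores_exact0 _ _ I); rewrite /= linearB -vE uE subrr.
  exists w' => x; apply: (@cores_aug_inj _ _ I).
  have ei0 : res_aug P (i (e x)) = 0 by apply/ex_i; exists (e x).
  by rewrite w'E -eE /= gE /= hE ei0 linear0 subr0.
have [K [i [i_inj ex_i]]] := kernelP (res_aug P).
have [e [e_surj ex_e _]] := shift_aug i_inj ex_i.
have K0 : coExt_vanishes t.+1 K.
  apply: (coExt_kernel i_inj ex_i (res_aug_surj P)) M0.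
  exact: coExt_projective.
exact: (IH K K0 (shift_resolution e_surj ex_e) (fun n => projP n.+1) f cf).
Qed.

End ExtByCoresolution.

Lemma edell_le_ddell k M : (1 <= k)%N -> (edell k M <= ddell k M)%EN.
Proof.
move=> k_gt0; apply: le_einf => m [n [le_nm [C [_ C0 dellC]]]].
apply: einf_le_mem => -[//|s] _ X /einf_eqP[I [injI I0]].
rewrite addnS; apply: (Ext_vanishes_coExt injI).
apply: (coExt_resolution injI (C := C)).
  by apply: C0; rewrite ltnS (leq_trans le_nm) ?leq_addr.
move=> i; rewrite ltnS => le_ims; case: (leqP i n) => [le_in | /C0]; last first.
  exact: coExt_zero_module.
have le_im := leq_trans le_in le_nm.
rewrite -addnS -addnBAC //; apply: (coExt_dell injI (dellC i le_in)) => N t le_t.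
apply/coExt_zero_obj/I0; apply: leq_trans le_t.
rewrite addnA (addnAC _ _ i) subnK // (addnAC m _ k).
by rewrite ltn_add2r subn1 ltn_predL addn_gt0 k_gt0 orbT.
Qed.

Lemma simple_finitely_generated S : simple_module S -> finitely_generated S.
Proof.
move=> [[x x_neq0] simS]; pose U : {pred S} := fun y => `[< exists c, y = c *: x >].
have [|U0|UT] := simS U.
- split=> [|a _ _ /asboolP[c ->] /asboolP[d ->]]; apply/asboolP.
    by exists 0; rewrite scale0r.
  by exists (a * c + d); rewrite scalerDl scalerA.
- by case/eqP: x_neq0; apply: U0; apply/asboolP; exists 1; rewrite scale1r.
exists 1%N, (fun=> x) => y; have /asboolP[c ->] := UT y.
by exists (fun=> c); rewrite big_ord1.
Qed.

Section TrivialResolution.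
Variable M : lmodType R.

Let obj i : lmodType R := if i is 0%N then M else 'rV[R]_0.
Let d i : {linear obj i.+1 -> obj i} := \0.

Definition trivial_resolution : resolution M.
Proof.
refine (@Resolution R M obj d idfun _ _ _).
- by move=> y; exists y.
- by move=> y; split=> [/= ->|[x <-]] //; exists 0.
by move=> i y; split=> [_|_]; [exists 0; exact/esym/thinmx0|].
Defined.

End TrivialResolution.

Lemma ddell_le_dell k M : finitely_generated M -> (ddell k M <= dell k M)%EN.
Proof.
move=> fgM; apply: le_einf => m dell_m; apply: einf_le_mem.
exists 0%N; split=> //; exists (trivial_resolution M); split.
- case=> [//|i]; exists 0%N, (fun=> 0) => x; exists (fun=> 0).
  by rewrite big_ord0; apply: thinmx0.
- by case=> // i _ x; apply: thinmx0.
by case=> // _; rewrite add0n subn0; apply: einf_le_mem.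
Qed.

End Modules.

Theorem mainTheorem6 (F : fieldType) (Lambda : falgType F) (k : nat) (hk : (1 <= k)%N) :
  (edell_alg Lambda k <= ddell_alg Lambda k <= dell_alg Lambda k)%EN.
Proof.
apply/andP; split; apply: le_sup_simples => S simS; first exact: edell_le_ddell.
exact/ddell_le_dell/simple_finitely_generated.
Qed.
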